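(* Let $\mathcal{A}$ be a unital $C^*$-algebra, $\mathcal{H}$ a Hilbert $\mathcal{A}$-module, $K\in End_{\mathcal{A}}^{*}(\mathcal{H})$, and $\mathbb{J}\subseteq\mathbb{N}$ a finite or countable index set. For $n=1,2,\dots,k$, let $\{T_{n,i}\}_{i\in\mathbb{J}}\subset End_{\mathcal{A}}^{*}(\mathcal{H})$ be a $K$-operator frame for $End_{\mathcal{A}}^{*}(\mathcal{H})$ with bounds $A_n$ and $B_n$, and let $\{\alpha_n\}_{n=1}^{k}$ be any scalars. If there exist a constant $\lambda>0$ and $p\in\{1,2,\dots,k\}$ such that $$\lambda\big\|\{T_{p,i}x\}_{i}\big\|\le\Big\|\Big\{\sum_{n=1}^{k}\alpha_nT_{n,i}x\Big\}_{i}\Big\|\qquad\text{for all }x\in\mathcal{H},$$ then $\big\{\sum_{n=1}^{k}\alpha_nT_{n,i}\big\}_{i\in\mathbb{J}}$ is a $K$-operator frame for $End_{\mathcal{A}}^{*}(\mathcal{H})$. The converse holds if $K$ is a co-isometry: in that case, if $\big\{\sum_{n=1}^{k}\alpha_nT_{n,i}\big\}_{i\in\mathbb{J}}$ is a $K$-operator frame for $End_{\mathcal{A}}^{*}(\mathcal{H})$, then there exist a constant $\lambda>0$ and $p\in\{1,2,\dots,k\}$ such that the displayed inequality holds.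
   Context: Hilbert $\mathcal{A}$-modules are left modules with $\mathcal{A}$-valued inner product $\langle\cdot,\cdot\rangle$, $\mathcal{A}$-linear in the first variable, with $\langle x,y\rangle=\langle y,x\rangle^*$, complete for $\|x\|=\|\langle x,x\rangle\|^{1/2}$. $End_{\mathcal{A}}^{*}(\mathcal{H})$ is the set of adjointable operators on $\mathcal{H}$. Inequalities between elements of $\mathcal{A}$ refer to the usual order given by the positive cone of $\mathcal{A}$. Scalars are complex numbers. For $K\in End_{\mathcal{A}}^{*}(\mathcal{H})$, a family $\{T_i\}_{i\in\mathbb{J}}\subset End_{\mathcal{A}}^{*}(\mathcal{H})$ is a $K$-operator frame for $End_{\mathcal{A}}^{*}(\mathcal{H})$ with (lower and upper) bounds $A,B>0$ if $A\langle K^*x,K^*x\rangle\le\sum_{i\in\mathbb{J}}\langle T_ix,T_ix\rangle\le B\langle x,x\rangle$ for all $x\in\mathcal{H}$; it is a $K$-operator frame if such constants exist. $K$ is a co-isometry if $\|K^*x\|=\|x\|$ for all $x\in\mathcal{H}$. $\ell^2(\mathcal{H})$ is the Hilbert $\mathcal{A}$-module of sequences $\{x_i\}_{i\in\mathbb{J}}$ in $\mathcal{H}$ with $\sum_i\langle x_i,x_i\rangle$ norm convergent, and $\|\{x_i\}_i\|=\|\sum_{i}\langle x_i,x_i\rangle\|^{1/2}$. Convention: all series $\sum_{i\in\mathbb{J}}\langle T_ix,T_ix\rangle$ are taken to converge in norm in $\mathcal{A}$ (i.e. $\{T_ix\}_i\in\ell^2(\mathcal{H})$); this convergence is part of the notion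 of $K$-operator frame. *)

(* Defs.v *)
From HB Require Import structures.
From mathcomp Require Import all_boot all_order all_algebra.
From mathcomp Require Export complex.
From mathcomp Require Import all_classical all_reals all_analysis.

Set Implicit Arguments.
Unset Strict Implicit.
Unset Printing Implicit Defensive.

Import Order.TTheory GRing.Theory Num.Theory numFieldNormedType.Exports.
Local Open Scope classical_set_scope.
Local Open Scope ring_scope.
Local Open Scope complex_scope.

(* Sequences in a zmodule, with respect to an explicit norm function.  The
   norm classes of the library are not used: Hierarchy Builder accepts no
   structure that is both a ring and a normedModType over another ring, since
   numDomainType is the declared join of rings and normed zmodules. *)
Section NormedSequences.
Context {R : realType} {V : zmodType}.
Variable nrm : V -> R.

Definition cvg_in_norm (u : nat -> V) (l : V) : Prop :=
  (fun n => nrm (u n - l)) @ \oo --> (0 : R).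

Definition cauchy_in_norm (u : nat -> V) : Prop :=
  forall e : R, 0 < e -> exists N : nat, forall m n : nat,
    (N <= m)%N -> (N <= n)%N -> nrm (u m - u n) < e.

Definition complete_in_norm : Prop :=
  forall u, cauchy_in_norm u -> exists l, cvg_in_norm u l.

End NormedSequences.

HB.mixin Record isCStarAlgebra (R : realType) A of GRing.Algebra R[i] A := {
  cnorm : A -> R ;
  star : A -> A ;
  cnormD_le : forall a b, cnorm (a + b) <= cnorm a + cnorm b ;
  cnormZ : forall (z : R[i]) a, cnorm (z *: a) = ComplexField.Normc.normc z * cnorm a ;
  cnorm0_eq0 : forall a, cnorm a = 0 -> a = 0 ;
  cnormM_le : forall a b, cnorm (a * b) <= cnorm a * cnorm b ;
  cnorm_complete : complete_in_norm cnorm ;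
  starD : forall a b, star (a + b) = star a + star b ;
  starZ : forall (z : R[i]) a, star (z *: a) = z^* *: star a ;
  starM : forall a b, star (a * b) = star b * star a ;
  starK : forall a, star (star a) = a ;
  cnorm_star_mul : forall a, cnorm (star a * a) = cnorm a ^+ 2
}.

#[short(type="cstarAlgType")]
HB.structure Definition CStarAlgebra (R : realType) :=
  {A of isCStarAlgebra R A & GRing.Algebra R[i] A}.

Section PositiveCone.
Context {R : realType} {A : cstarAlgType R}.

Definition spectrum (a : A) : set R[i] :=
  [set z | ~ exists b : A, b * (a - z%:A) = 1 /\ (a - z%:A) * b = 1].

Definition positive (a : A) : Prop :=
  star a = a /\ forall z, spectrum a z -> 0 <= z.

Definition cstar_le (a b : A) : Prop := positive (b - a).

End PositiveCone.

(* There is no separate C-vector space structure: a complex scalar z acts on a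
   Hilbert A-module through z%:A = z *: 1. *)
HB.mixin Record isHilbertModule (R : realType) (A : cstarAlgType R) H
    of GRing.Lmodule A H := {
  inner : H -> H -> A ;
  innerDl : forall x y z, inner (x + y) z = inner x z + inner y z ;
  innerZl : forall (a : A) x y, inner (a *: x) y = a * inner x y ;
  inner_star : forall x y, inner x y = star (inner y x) ;
  inner_ge0 : forall x, positive (inner x x) ;
  inner_eq0 : forall x, inner x x = 0 -> x = 0 ;
  inner_complete : complete_in_norm (fun x => Num.sqrt (cnorm (inner x x)))
}.

#[short(type="hilbertModType")]
HB.structure Definition HilbertModule (R : realType) (A : cstarAlgType R) :=
  {H of isHilbertModule R A H & GRing.Lmodule A H}.

Definition hnorm (R : realType) (A : cstarAlgType R) (H : hilbertModType A)
  (x : H) : R := Num.sqrt (cnorm (inner x x)).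

(* The adjoint is determined by the operator since inner is definite, so
   carrying it as a field adds no structure. *)
Record adjointable (R : realType) (A : cstarAlgType R) (H : hilbertModType A) :=
  Adjointable {
    aop :> H -> H ;
    adj : H -> H ;
    adjP : forall x y, inner (aop x) y = inner x (adj y) }.

Section LinearCombination.
Context {R : realType} {A : cstarAlgType R} {H : hilbertModType A} {k : nat}.
Variables (alpha : 'I_k -> R[i]) (T : 'I_k -> adjointable H).

Let comb x := \sum_(n < k) (alpha n)%:A *: T n x.
Let comb_adj y := \sum_(n < k) ((alpha n)^*)%:A *: adj (T n) y.

Fact aop_lincomb_adjP x y : inner (comb x) y = inner x (comb_adj y).
Proof.
have inner0l v : inner 0 v = 0 by rewrite -[0 in LHS](scale0r 0) innerZl mul0r.
have star0 : star (0 : A) = 0 by apply: (addrI (star 0)); rewrite -starD !addr0.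
have star1 : star (1 : A) = 1.
  by rewrite -[LHS]mulr1 -{2}(starK 1) -starM mulr1 starK.
have -> : inner (comb x) y = \sum_(n < k) inner ((alpha n)%:A *: T n x) y.
  by apply: (big_morph (inner^~ y)) => // u v; rewrite innerDl.
have -> : inner x (comb_adj y) =
    \sum_(n < k) inner x (((alpha n)^*)%:A *: adj (T n) y).
  apply: (big_morph (inner x)) => [u v|].
    by rewrite !(inner_star x) innerDl starD.
  by rewrite inner_star inner0l.
apply: eq_bigr => n _.
rewrite innerZl (inner_star x) innerZl starM -inner_star starZ star1 conjCK.
by rewrite -scalerAl -scalerAr mul1r mulr1 adjP.
Qed.

Definition aop_lincomb : adjointable H := Adjointable aop_lincomb_adjP.

End LinearCombination.

Section OperatorFrames.
Context {R : realType} {A : cstarAlgType R} {H : hilbertModType A}.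

(* A family indexed by J : set nat is a function on nat of which only the
   values on J are used. *)
Definition l2_partial_sums (J : set nat) (x : nat -> H) : nat -> A :=
  fun m => \sum_(0 <= i < m | i \in J) inner (x i) (x i).

Definition in_l2 (J : set nat) (x : nat -> H) : Prop :=
  exists s : A, cvg_in_norm cnorm (l2_partial_sums J x) s.

(* The norm limit of the series, and 0 by default if it diverges. *)
Definition l2_sum (J : set nat) (x : nat -> H) : A :=
  xget 0 [set s | cvg_in_norm cnorm (l2_partial_sums J x) s].

Definition l2_norm (J : set nat) (x : nat -> H) : R :=
  Num.sqrt (cnorm (l2_sum J x)).

Definition K_operator_frame_with_bounds (K : adjointable H) (J : set nat)
    (T : nat -> adjointable H) (a b : R) : Prop :=
  [/\ 0 < a, 0 < b &
    forall x : H,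
      [/\ in_l2 J (fun i => T i x),
          cstar_le (a%:C *: inner (adj K x) (adj K x))
                   (l2_sum J (fun i => T i x)) &
          cstar_le (l2_sum J (fun i => T i x)) (b%:C *: inner x x)]].

Definition K_operator_frame (K : adjointable H) (J : set nat)
    (T : nat -> adjointable H) : Prop :=
  exists a b : R, K_operator_frame_with_bounds K J T a b.

Definition co_isometry (K : adjointable H) : Prop :=
  forall x : H, hnorm (adj K x) = hnorm x.

End OperatorFrames.

(* Main.v *)
(* The upper bound is the parallelogram law <y + z, y + z> <= 2 <y, y> + 2 <z, z>,
   iterated.  For the lower bound, the norm inequality, valid at every vector,
   has to be turned into an order inequality.  With Phi x = <Sx, Sx> and s > 0,
   let g be the square root of Phi x + s and h its inverse.  At the vector h x
   one has |Phi (h x)| = |1 - s h^2| <= 1, so the norm inequality gives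
   |h Psi(x) h| < 1 for Psi x = c <K^*x, K^*x>, and
   Phi x - Psi x + s = g (1 - h Psi(x) h) g is invertible for every s > 0.

   Positivity is handled without Gelfand theory.  Square roots of 1 - x for
   |x| < 1 come from the contraction y |-> (x + y^2) / 2, and if d and e are
   commuting self-adjoint elements with d^2 + e^2 = m, then d + i e is sqrt m
   times a unitary, whence |d^2| <= m.  This replaces the spectral radius
   formula.  Spectral positivity of a is related to norms by lowering s from |a|
   to 0 in a + s: invertibility along the way keeps the element in the interior
   of the cone. *)
Require Import Defs.
From mathcomp Require Import all_boot all_order all_algebra.
From mathcomp Require Import all_classical all_reals all_analysis.
From mathcomp Require Import ring lra.

Set Implicit Arguments.
Unset Strict Implicit.
Unset Printing Implicit Defensive.

Import Order.TTheory GRing.Theory Num.Theory numFieldNormedType.Exports.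
Local Open Scope ring_scope.
Local Open Scope complex_scope.

(** * Norm and involution of a C*-algebra *)

Section NormAndStar.
Context {R : realType} {A : cstarAlgType R}.
Implicit Types (a b c d x y : A) (r : R).

Lemma normc_real r : ComplexField.Normc.normc r%:C = `|r|.
Proof. by rewrite /= expr0n addr0 sqrtr_sqr. Qed.

Lemma cnormZr r a : cnorm (r%:C *: a) = `|r| * cnorm a.
Proof. by rewrite cnormZ normc_real. Qed.

Lemma cnorm0 : cnorm (0 : A) = 0.
Proof. by rewrite -(scale0r 0) cnormZ ComplexField.Normc.normc0 mul0r. Qed.

Lemma cnormN a : cnorm (- a) = cnorm a.
Proof. by rewrite -scaleN1r -(rmorphN1 (real_complex R)) cnormZr normrN1 mul1r. Qed.

Lemma cnormBC a b : cnorm (a - b) = cnorm (b - a).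
Proof. by rewrite -cnormN opprB. Qed.

Lemma cnormB_le a b : cnorm (a - b) <= cnorm a + cnorm b.
Proof. by rewrite -(cnormN b) cnormD_le. Qed.

Lemma cnorm_ge0 a : 0 <= cnorm a.
Proof. by have := cnormB_le a a; rewrite subrr cnorm0; lra. Qed.

Lemma cnorm_dist b a c : cnorm (a - c) <= cnorm (a - b) + cnorm (b - c).
Proof. by rewrite -[a - c](subrKA b) cnormD_le. Qed.

Lemma cnorm_le_dist a b : cnorm a <= cnorm (a - b) + cnorm b.
Proof. by rewrite -{1}(subrK b a) cnormD_le. Qed.

Lemma star0 : star (0 : A) = 0.
Proof. by apply: (addrI (star 0)); rewrite -starD !addr0. Qed.

Lemma starN a : star (- a) = - star a.
Proof. by apply: (addrI (star a)); rewrite -starD !subrr star0. Qed.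

Lemma starB a b : star (a - b) = star a - star b.
Proof. by rewrite starD starN. Qed.

Lemma star1 : star (1 : A) = 1.
Proof. by rewrite -[LHS]mulr1 -{2}(starK 1) -starM mulr1 starK. Qed.

Lemma starZr r a : star (r%:C *: a) = r%:C *: star a.
Proof. by rewrite starZ; congr (_ *: _); exact: conjc_real. Qed.

Lemma star_scalar r : star (r%:C%:A : A) = r%:C%:A.
Proof. by rewrite starZr star1. Qed.

(** The C*-identity and submultiplicativity give [cnorm b ^+ 2 <= cnorm (star b) * cnorm b]; cancel
    [cnorm b], then apply the result to [star a] as well. *)
Lemma cnorm_star a : cnorm (star a) = cnorm a.
Proof.
have le_star b : cnorm b <= cnorm (star b).
  have := cnorm_ge0 b; rewrite le_eqVlt => /predU1P[<-|b_gt0].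
    exact: cnorm_ge0.
  have := cnormM_le (star b) b; rewrite cnorm_star_mul expr2.
  by rewrite ler_pM2r.
by apply/le_anti; rewrite le_star -{2}(starK a) le_star.
Qed.

Lemma cnorm_sqr d : star d = d -> cnorm (d * d) = cnorm d ^+ 2.
Proof. by move=> d_sa; rewrite -cnorm_star_mul d_sa. Qed.

Lemma cnorm1_le : cnorm (1 : A) <= 1.
Proof.
have := cnorm_sqr star1; rewrite mulr1 => h.
have := cnorm_ge0 (1 : A); rewrite le_eqVlt => /predU1P[<-|c_gt0] //.
by rewrite -(ler_pM2r c_gt0) mul1r -expr2 -h.
Qed.

Lemma cnorm_scalar_le r : cnorm (r%:C%:A : A) <= `|r|.
Proof. by rewrite cnormZr ler_piMr ?cnorm1_le. Qed.

Lemma realZDl r s a : (r + s)%:C *: a = r%:C *: a + s%:C *: a.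
Proof. by rewrite rmorphD scalerDl. Qed.

Lemma realZBl r s a : (r - s)%:C *: a = r%:C *: a - s%:C *: a.
Proof. by rewrite rmorphB scalerBl. Qed.

Lemma realZA r s a : r%:C *: (s%:C *: a) = (r * s)%:C *: a.
Proof. by rewrite scalerA rmorphM. Qed.

Lemma realZK r a : r != 0 -> r%:C *: (r^-1%:C *: a) = a.
Proof. by move=> r0; rewrite realZA divff ?scale1r. Qed.

End NormAndStar.

(** * Norm limits and Banach's fixed-point theorem *)

Section Limits.
Context {R : realType} {A : cstarAlgType R}.
Implicit Types (u v : nat -> A) (a b l m : A).

Lemma cvg_in_normP u l : cvg_in_norm cnorm u l <->
  forall e : R, 0 < e -> exists N, forall n, (N <= n)%N -> cnorm (u n - l) < e.
Proof.
split=> [/cvgrPdist_lt h e e_gt0|h].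
  have [N _ hN] := h e e_gt0; exists N => n /hN /=.
  by rewrite sub0r normrN ger0_norm ?cnorm_ge0.
apply/cvgrPdist_lt => e e_gt0; have [N hN] := h e e_gt0.
by exists N => // n /hN /=; rewrite sub0r normrN ger0_norm ?cnorm_ge0.
Qed.

Lemma cvg_in_norm_ext u v l : (forall n, u n = v n) ->
  cvg_in_norm cnorm u l -> cvg_in_norm cnorm v l.
Proof. by move=> uv; rewrite (funext uv). Qed.

Lemma cvg_in_normD u v l m : cvg_in_norm cnorm u l -> cvg_in_norm cnorm v m ->
  cvg_in_norm cnorm (fun n => u n + v n) (l + m).
Proof.
move=> /cvg_in_normP ul /cvg_in_normP vm; apply/cvg_in_normP => e e_gt0.
have e2 : 0 < e / 2 by lra.
have [N hN] := ul _ e2; have [M hM] := vm _ e2.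
exists (maxn N M) => n; rewrite geq_max => /andP[/hN ? /hM ?].
by rewrite opprD addrACA; have := cnormD_le (u n - l) (v n - m); lra.
Qed.

Lemma cvg_in_norm_lipschitz (f : A -> A) (M : R) u l :
  (forall a b, cnorm (f a - f b) <= M * cnorm (a - b)) ->
  cvg_in_norm cnorm u l -> cvg_in_norm cnorm (fun n => f (u n)) (f l).
Proof.
move=> f_lip /cvg_in_normP ul; apply/cvg_in_normP => e e_gt0.
(* [M] may be zero or negative, so [e] is divided by the positive number [|M| + 1] instead. *)
have M1_gt0 : 0 < `|M| + 1 by have := normr_ge0 M; lra.
have [N hN] := ul _ (divr_gt0 e_gt0 M1_gt0).
exists N => n /hN; rewrite ltr_pdivlMr // => h.
apply: le_lt_trans (f_lip _ _) _; apply: le_lt_trans h.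
rewrite mulrC ler_wpM2l ?cnorm_ge0 //; have := ler_norm M; lra.
Qed.

Lemma cvg_in_normZ (z : R[i]) u l : cvg_in_norm cnorm u l ->
  cvg_in_norm cnorm (fun n => z *: u n) (z *: l).
Proof.
apply: (@cvg_in_norm_lipschitz _ (ComplexField.Normc.normc z)) => a b.
by rewrite -scalerBr cnormZ.
Qed.

Lemma cvg_in_normMlr a b u l : cvg_in_norm cnorm u l ->
  cvg_in_norm cnorm (fun n => a * u n * b) (a * l * b).
Proof.
apply: (@cvg_in_norm_lipschitz (fun c => a * c * b) (cnorm a * cnorm b)) => c d.
rewrite -mulrBl -mulrBr mulrAC; apply: le_trans (cnormM_le _ _) _.
by rewrite ler_wpM2r ?cnorm_ge0 // cnormM_le.
Qed.

Lemma cvg_in_norm0 : cvg_in_norm cnorm (fun=> 0 : A) 0.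
Proof.
by apply/cvg_in_normP => e e_gt0; exists 0%N => n _; rewrite subr0 cnorm0.
Qed.

Lemma cvg_in_norm_sum (I : finType) (F : I -> nat -> A) (L : I -> A) :
  (forall i, cvg_in_norm cnorm (F i) (L i)) ->
  cvg_in_norm cnorm (fun n => \sum_i F i n) (\sum_i L i).
Proof.
move=> FL; have : forall s : seq I,
  cvg_in_norm cnorm (fun n => \sum_(i <- s) F i n) (\sum_(i <- s) L i).
  elim=> [|i s IHs].
    by rewrite big_nil; apply: cvg_in_norm_ext cvg_in_norm0 => n; rewrite big_nil.
  rewrite big_cons; apply: cvg_in_norm_ext (cvg_in_normD (FL i) IHs) => n.
  by rewrite big_cons.
exact.
Qed.

Lemma cvg_in_norm_le u l (M : R) : cvg_in_norm cnorm u l ->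
  (forall n, cnorm (u n) <= M) -> cnorm l <= M.
Proof.
move=> /cvg_in_normP ul uM; apply/ler_addgt0Pr => e /ul[N /(_ N (leqnn N)) h].
by have := uM N; have := cnorm_le_dist l (u N); rewrite cnormBC; lra.
Qed.

Lemma cvg_in_norm_unique u l m :
  cvg_in_norm cnorm u l -> cvg_in_norm cnorm u m -> l = m.
Proof.
move=> /cvg_in_normP ul /cvg_in_normP um.
apply/eqP; rewrite -subr_eq0; apply/eqP/cnorm0_eq0/le_anti.
rewrite cnorm_ge0 andbT; apply/ler_addgt0Pr => e e_gt0.
have e2 : 0 < e / 2 by lra.
have [N hN] := ul _ e2; have [M hM] := um _ e2.
have := hN _ (leq_maxl N M); have := hM _ (leq_maxr N M).
by have := cnorm_dist (u (maxn N M)) l m; rewrite (cnormBC l (u _)); lra.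
Qed.

Lemma cvg_in_norm_star u l : cvg_in_norm cnorm u l ->
  cvg_in_norm cnorm (fun n => star (u n)) (star l).
Proof.
by apply: (@cvg_in_norm_lipschitz _ 1) => a b; rewrite -starB cnorm_star mul1r.
Qed.

(** Banach iteration started at 0. The closed invariant set [D] carries side conditions, such as
    self-adjointness, over to the fixed point. *)
Lemma contraction_fixpoint (D : A -> Prop) (f : A -> A) (q : R) :
  0 <= q -> q < 1 -> D 0 -> (forall a, D a -> D (f a)) ->
  (forall a b, D a -> D b -> cnorm (f a - f b) <= q * cnorm (a - b)) ->
  (forall u l, (forall n, D (u n)) -> cvg_in_norm cnorm u l -> D l) ->
  exists y, D y /\ f y = y.
Proof.
move=> q_ge0 q_lt1 D0 Df f_lip D_closed.
pose u n := iter n f 0.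
have Du n : D (u n) by elim: n => //= n; exact: Df.
(* The sum of the geometric series, that is, the solution of [M = q * M + cnorm (f 0)]. It bounds
   all iterates, and applying [f] to both arguments [n] times then gives [M * q ^+ n]. *)
pose M := cnorm (f 0) / (1 - q).
have u_le n : cnorm (u n) <= M.
  elim: n => [|n IHn]; first by rewrite cnorm0 divr_ge0 ?cnorm_ge0 //; lra.
  have -> : M = q * M + cnorm (f 0) by rewrite /M; field; lra.
  apply: le_trans (cnorm_le_dist _ (f 0)) _; rewrite lerD2r.
  apply: le_trans (f_lip _ _ (Du n) D0) _.
  by rewrite subr0 ler_wpM2l.
have u_dist n (m : nat) : cnorm (u (n + m)%N - u n) <= M * q ^+ n.
  elim: n => [|n IHn]; first by rewrite add0n subr0 mulr1.
  rewrite addSn exprS mulrCA; apply: le_trans (f_lip _ _ (Du _) (Du _)) _.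
  by rewrite ler_wpM2l.
have q_cvg : ((fun n => M * q ^+ n) @ \oo --> (0 : R))%classic.
  by apply: cvg_geometric; rewrite ger0_norm.
have small (e : R) : 0 < e -> exists N, forall m : nat, cnorm (u (N + m)%N - u N) < e.
  move=> e_gt0; have /cvgrPdist_lt/(_ e e_gt0)[N _ hN] := q_cvg.
  exists N => m; apply: le_lt_trans (u_dist _ _) _.
  have /= := hN N (leqnn N); rewrite sub0r normrN.
  by apply: le_lt_trans; rewrite ler_norm.
have [l ul] : exists l, cvg_in_norm cnorm u l.
  apply: cnorm_complete => e e_gt0; have e2 : 0 < e / 2 by lra.
  have [N hN] := small _ e2; exists N => m n /subnKC <- /subnKC <-.
  have := cnorm_dist (u N) (u (N + (m - N))%N) (u (N + (n - N))%N).
  have := hN (m - N)%N; have := hN (n - N)%N.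
  rewrite (cnormBC (u N)); lra.
exists l; split; first exact: D_closed ul.
have Dl : D l by exact: D_closed ul.
apply/eqP; rewrite -subr_eq0; apply/eqP/cnorm0_eq0/le_anti.
rewrite cnorm_ge0 andbT; apply/ler_addgt0Pr => e e_gt0.
have e2 : 0 < e / 2 by lra.
move/cvg_in_normP: ul => /(_ _ e2)[N hN].
have := hN N (leqnn N); have := hN N.+1 (leqnSn N).
have := cnorm_dist (u N.+1) (f l) l.
have := f_lip _ _ Dl (Du N); rewrite -[f (u N)]/(u N.+1) (cnormBC l).
have : q * cnorm (u N - l) <= 1 * cnorm (u N - l).
  by rewrite ler_wpM2r ?cnorm_ge0 ?ltW.
lra.
Qed.

End Limits.

(** * Neumann series, square roots near 1, and norms of squares *)

Section InversesAndSquareRoots.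
Context {R : realType} {A : cstarAlgType R}.
Implicit Types (a b c d e g x y : A) (r s t : R).

Definition mul_inverse c y := c * y = 1 /\ y * c = 1.

(** A right inverse is a fixed point of [y |-> 1 + x * y] and a left inverse one of
    [z |-> 1 + z * x]; they coincide by associativity. The bound rearranges
    [cnorm y <= 1 + cnorm x * cnorm y]. *)
Lemma neumann x : cnorm x < 1 ->
  exists y, mul_inverse (1 - x) y /\ cnorm y * (1 - cnorm x) <= 1.
Proof.
move=> x_lt1.
have fixpoint f : (forall a b, cnorm (f a - f b) <= cnorm x * cnorm (a - b)) ->
    exists y : A, f y = y.
  move=> f_lip; case: (@contraction_fixpoint R A (fun=> True) f (cnorm x)) => //.
    exact: cnorm_ge0.
  by move=> y [_ fy]; exists y.
have [y yE] : exists y : A, 1 + x * y = y.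
  by apply: fixpoint => a b; rewrite [1 + _]addrC addrKA -mulrBr cnormM_le.
have [z zE] : exists z : A, 1 + z * x = z.
  apply: fixpoint => a b; rewrite [1 + _]addrC addrKA -mulrBl mulrC.
  exact: cnormM_le.
have y_r : (1 - x) * y = 1 by rewrite mulrBl mul1r -{1}yE addrK.
have z_l : z * (1 - x) = 1 by rewrite mulrBr mulr1 -{1}zE addrK.
have zy : z = y by rewrite -[z]mulr1 -y_r mulrA z_l mul1r.
exists y; split; first by split=> //; rewrite -zy.
rewrite mulrBr mulr1 lerBlDr -{1}yE; apply: le_trans (cnormD_le _ _) _.
by rewrite lerD ?cnorm1_le // mulrC cnormM_le.
Qed.

(** A fixed point of [f] satisfies [y + y = x + y * y], which is [(1 - y) * (1 - y) = 1 - x]. *)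
Lemma sqrt_one_sub x : cnorm x < 1 -> star x = x -> exists g,
  [/\ star g = g, g * g = 1 - x & forall b, b * x = x * b -> b * g = g * b].
Proof.
move=> x_lt1 x_sa; have x_ge0 := cnorm_ge0 x.
pose f y := 2^-1%:C *: (x + y * y).
have f2 y : f y + f y = x + y * y.
  by rewrite /f -realZDl (_ : 2^-1 + 2^-1 = 1 :> R) ?scale1r //; field.
(* The radius [cnorm x] makes [f] contract with constant [cnorm x]; the other two clauses survive
   the limit and give the properties of the root. *)
pose D y := [/\ cnorm y <= cnorm x, star y = y &
  forall b, b * x = x * b -> b * y = y * b].
case: (@contraction_fixpoint R A D f (cnorm x)) => //.
- by split=> [||b _]; rewrite ?cnorm0 ?star0 ?mul0r ?mulr0.
- move=> y [y_le y_sa y_comm]; split=> [||b bx].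
  + rewrite cnormZr ger0_norm ?invr_ge0 //.
    have := cnormD_le x (y * y); have := cnormM_le y y.
    have : cnorm y * cnorm y <= cnorm x * 1.
      by rewrite ler_pM ?cnorm_ge0 // (le_trans y_le) ?ltW.
    lra.
  + by rewrite starZr starD starM x_sa y_sa.
  + have yb := y_comm b bx.
    by rewrite -scalerAr -scalerAl mulrDr mulrDl bx mulrA yb -mulrA yb mulrA.
- move=> y z [y_le _ _] [z_le _ _].
  (* [y] and [z] need not commute, so the difference of squares is split in this asymmetric way. *)
  have -> : f y - f z = 2^-1%:C *: (y * (y - z) + (y - z) * z).
    by rewrite -scalerBr [x + y * y]addrC addrKA mulrBr mulrBl addrA subrK.
  rewrite cnormZr ger0_norm ?invr_ge0 //.
  have := cnormD_le (y * (y - z)) ((y - z) * z).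
  have := cnormM_le y (y - z); have := cnormM_le (y - z) z.
  have : cnorm y * cnorm (y - z) <= cnorm x * cnorm (y - z).
    by rewrite ler_wpM2r ?cnorm_ge0.
  have : cnorm (y - z) * cnorm z <= cnorm x * cnorm (y - z).
    by rewrite mulrC ler_wpM2r ?cnorm_ge0.
  lra.
- move=> u l Du ul; split=> [||b bx].
  + by apply: cvg_in_norm_le ul _ => n; case: (Du n).
  + apply: cvg_in_norm_unique (cvg_in_norm_star ul) _.
    by apply: cvg_in_norm_ext ul => n; case: (Du n).
  + apply: (@cvg_in_norm_unique _ _ (fun n => b * u n)).
      by have := cvg_in_normMlr b 1 ul; rewrite mulr1; apply: cvg_in_norm_ext => n;
         rewrite mulr1.
    have := cvg_in_normMlr 1 b ul; rewrite mul1r.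
    by apply: cvg_in_norm_ext => n; rewrite mul1r; case: (Du n) => _ _ ->.
- move=> y [[_ y_sa y_comm] fy]; exists (1 - y); split=> [||b bx].
  + by rewrite starB star1 y_sa.
  + rewrite mulrBl mul1r mulrBr mulr1.
    have := f2 y; rewrite fy => yy.
    have -> : y * y = y + y - x by rewrite yy addrC addKr.
    by rewrite opprB [X in _ + X]addrAC addrK subrKA.
  + by rewrite mulrBr mulrBl mulr1 mul1r y_comm.
Qed.

(** Commutation cancels the cross terms in [star v * v], leaving [m]; and [d] is the real part of
    [v], so [cnorm d <= cnorm v]. *)
Lemma cnorm_sqr_le_of_sum_sqr d e (m : R) : 0 <= m -> star d = d -> star e = e ->
  d * e = e * d -> d * d + e * e = m%:C%:A -> cnorm (d * d) <= m.
Proof.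
move=> m_ge0 d_sa e_sa de sum_m.
pose v := d + 'i%C *: e.
have star_v : star v = d - 'i%C *: e.
  rewrite /v starD starZ d_sa e_sa; congr (_ + _); rewrite -scaleNr.
  by congr (_ *: _); apply/eqP; rewrite eq_complex /= oppr0 !eqxx.
have v_sqr : star v * v = m%:C%:A.
  have ii : 'i%C * 'i%C = -1 :> R[i] by rewrite -expr2 sqr_i.
  rewrite star_v /v mulrBl !mulrDr -!scalerAl -!scalerAr de scalerA ii.
  by rewrite scaleN1r opprD opprK addrA addrK.
have v_le : cnorm v ^+ 2 <= m.
  by rewrite -cnorm_star_mul v_sqr (le_trans (cnorm_scalar_le _)) ?ger0_norm.
have dd : d + d = v + star v by rewrite star_v /v addrACA subrr addr0.
have d_le : cnorm d <= cnorm v.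
  have := cnormD_le v (star v); rewrite -dd cnorm_star.
  have -> : d + d = 2%:C *: d by rewrite -[2]/(1 + 1) realZDl scale1r.
  by rewrite cnormZr ger0_norm //; lra.
by rewrite cnorm_sqr // (le_trans _ v_le) // lerXn2r ?nnegrE ?cnorm_ge0.
Qed.

(** For [s] above [cnorm d ^+ 2], the element [s - d * d] is the square of some [h] commuting with
    [d], and the preceding bound applies to [h * h + d * d = s]. *)
Lemma cnorm_scalar_sub_sqr_le d t : star d = d -> cnorm d ^+ 2 <= t ->
  cnorm (t%:C%:A - d * d) <= t.
Proof.
move=> d_sa d_le; apply/ler_addgt0Pr => e e_gt0.
have t_ge0 : 0 <= t by apply: le_trans d_le; rewrite exprn_ge0 ?cnorm_ge0.
(* Strictly above [cnorm d ^+ 2], so that [d * d / s] has norm below 1; the other [e / 2] pays for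
   returning from [s] to [t]. *)
pose s := t + e / 2; have s_gt0 : 0 < s by rewrite /s; lra.
have s_neq0 := lt0r_neq0 s_gt0.
pose x := s^-1%:C *: (d * d).
have dd_sa : star (d * d) = d * d by rewrite starM d_sa.
have [g [g_sa gg g_comm]] : exists g, [/\ star g = g, g * g = 1 - x &
    forall b, b * x = x * b -> b * g = g * b].
  apply: sqrt_one_sub; last by rewrite starZr dd_sa.
  rewrite cnormZr gtr0_norm ?invr_gt0 // mulrC ltr_pdivrMr // mul1r cnorm_sqr //.
  by rewrite /s; lra.
pose h := (Num.sqrt s)%:C *: g.
have hh : h * h = s%:C%:A - d * d.
  rewrite /h -scalerAl -scalerAr realZA -expr2 sqr_sqrtr ?(ltW s_gt0) // gg.
  by rewrite scalerBr realZK.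
have dg : d * g = g * d.
  by apply: g_comm; rewrite /x -scalerAr -scalerAl mulrA.
have h_le : cnorm (h * h) <= s.
  apply: (@cnorm_sqr_le_of_sum_sqr _ d); rewrite ?(ltW s_gt0) //.
  - by rewrite starZr g_sa.
  - by rewrite /h -scalerAl -scalerAr dg.
  - by rewrite hh subrK.
have := cnorm_dist s%:C%:A t%:C%:A (d * d); rewrite -hh -realZBl.
have := @cnorm_scalar_le R A (t - s).
have sE : s = t + e / 2 by [].
by rewrite ler0_norm; lra.
Qed.

End InversesAndSquareRoots.

(** * The positive cone through norms, and its agreement with the spectral definition *)

Section PositiveElements.
Context {R : realType} {A : cstarAlgType R}.
Implicit Types (a b c d e g x y : A) (r s t : R).

(* A description of positivity that is visibly stable under sums and limits;
   [positiveP] identifies it with the spectral one. *)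
Definition npos a := star a = a /\ exists t, cnorm (t%:C%:A - a) <= t.

Lemma mul_inverse_comm c y b : mul_inverse c y -> b * c = c * b ->
  b * y = y * b.
Proof.
move=> [cy yc] bc; rewrite -[b * y]mul1r -yc -!mulrA; congr (_ * _).
by rewrite mulrA -bc -mulrA cy mulr1.
Qed.

Lemma mul_inverse_star c y : mul_inverse c y -> star c = c -> star y = y.
Proof.
move=> [cy _] c_sa; have star_yc : star y * c = 1.
  by rewrite -{1}c_sa -starM cy star1.
by rewrite -[LHS]mulr1 -cy mulrA star_yc mul1r.
Qed.

(** Write [a + s = (t + s) * (1 - x)] with [x = (t - a) / (t + s)]; adding [s > 0] makes
    [cnorm x < 1] strict. *)
Lemma npos_sqrt a s : npos a -> 0 < s -> exists g,
  [/\ star g = g, g * g = a + s%:C%:A & forall b, b * a = a * b -> b * g = g * b].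
Proof.
move=> [a_sa [t ta]] s_gt0.
have t_ge0 : 0 <= t := le_trans (cnorm_ge0 _) ta.
have ts_gt0 : 0 < t + s by lra.
pose x := (t + s)^-1%:C *: (t%:C%:A - a).
have x_lt1 : cnorm x < 1.
  rewrite cnormZr gtr0_norm ?invr_gt0 // mulrC ltr_pdivrMr // mul1r.
  by apply: le_lt_trans ta _; rewrite ltrDl.
have x_sa : star x = x by rewrite starZr starB star_scalar a_sa.
have [g [g_sa gg g_comm]] := sqrt_one_sub x_lt1 x_sa.
exists ((Num.sqrt (t + s))%:C *: g); split=> [||b ba].
- by rewrite starZr g_sa.
- rewrite -scalerAl -scalerAr realZA -expr2 sqr_sqrtr ?(ltW ts_gt0) // gg.
  rewrite scalerBr realZK ?(lt0r_neq0 ts_gt0) //.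
  by rewrite opprB addrCA realZDl addrAC subrr add0r.
- rewrite -scalerAl -scalerAr g_comm // /x -scalerAl -scalerAr.
  by rewrite mulrBl mulrBr mulr_algl mulr_algr ba.
Qed.

(** This replaces the unspecified witness in [npos] by any bound of the norm. It follows from the
    estimate for the square [a + e] as [e] tends to 0. *)
Lemma npos_le a t : npos a -> cnorm a <= t -> cnorm (t%:C%:A - a) <= t.
Proof.
move=> a_pos a_le; apply/ler_addgt0Pr => e e_gt0.
have [d [d_sa dd _]] := npos_sqrt a_pos e_gt0.
have := @cnorm_scalar_sub_sqr_le _ _ d (t + e) d_sa.
rewrite -cnorm_sqr // dd realZDl [a + _]addrC addrKA; apply.
have := cnormD_le e%:C%:A a; have := @cnorm_scalar_le R A e.
by rewrite gtr0_norm //; lra.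
Qed.

Lemma npos_near_scalar a t : star a = a -> cnorm a <= t -> npos (a + t%:C%:A).
Proof.
move=> a_sa a_le; split; first by rewrite starD star_scalar a_sa.
by exists t; rewrite [a + _]addrC opprD addNKr cnormN.
Qed.

Lemma npos_scalar t : 0 <= t -> npos (t%:C%:A : A).
Proof.
by move=> t_ge0; split; [rewrite star_scalar | exists t; rewrite subrr cnorm0].
Qed.

Lemma nposD a b : npos a -> npos b -> npos (a + b).
Proof.
move=> [a_sa [s sa]] [b_sa [t tb]]; split; first by rewrite starD a_sa b_sa.
exists (s + t); rewrite realZDl opprD addrACA.
by have := cnormD_le (s%:C%:A - a) (t%:C%:A - b); lra.
Qed.

Lemma npos0 : npos (0 : A).
Proof. by have := npos_scalar (lexx 0); rewrite scale0r. Qed.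

Lemma nposZ r a : 0 <= r -> npos a -> npos (r%:C *: a).
Proof.
move=> r_ge0 [a_sa [t ta]]; split; first by rewrite starZr a_sa.
by exists (r * t); rewrite -realZA -scalerBr cnormZr ger0_norm // ler_wpM2l.
Qed.

Lemma npos_sum (I : Type) (s : seq I) (P : pred I) (F : I -> A) :
  (forall i, npos (F i)) -> npos (\sum_(i <- s | P i) F i).
Proof. by move=> F_pos; apply: big_ind => //; [exact: npos0 | exact: nposD]. Qed.

Lemma npos_sqr d : star d = d -> npos (d * d).
Proof.
move=> d_sa; split; first by rewrite starM d_sa.
by exists (cnorm d ^+ 2); exact: cnorm_scalar_sub_sqr_le.
Qed.

(** The witnesses may vary with [s], but [npos_le] allows [cnorm a + s], which has a limit. *)
Lemma npos_approx a : (forall s, 0 < s -> npos (a + s%:C%:A)) -> npos a.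
Proof.
move=> a_pos; have a_sa : star a = a.
  by have [] := a_pos _ ltr01; rewrite starD star_scalar => /addIr.
split=> //; exists (cnorm a); apply/ler_addgt0Pr => e e_gt0.
have := npos_le (a_pos _ e_gt0) (t := cnorm a + e).
rewrite realZDl [a + _]addrC addrKA; apply.
by have := cnormD_le e%:C%:A a; have := @cnorm_scalar_le R A e; rewrite gtr0_norm //; lra.
Qed.

Lemma npos_lim u (l : A) : (forall n, npos (u n)) -> cvg_in_norm cnorm u l ->
  npos l.
Proof.
move=> u_pos ul; have l_sa : star l = l.
  apply: cvg_in_norm_unique (cvg_in_norm_star ul) _.
  by apply: cvg_in_norm_ext ul => n; case: (u_pos n).
apply: npos_approx => e /((cvg_in_normP _ _).1 ul)[N /(_ N (leqnn N)) uN].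
(* Split [l + e] as [(l - u N + e) + u N]; the first summand lies within [e] of the scalar [e]. *)
rewrite -(subrK (u N) l) -addrA [u N + _]addrC addrA; apply: nposD => //.
apply: npos_near_scalar; last by rewrite cnormBC ltW.
by rewrite starB l_sa (u_pos N).1.
Qed.

(** The elements [a + s] and [t - a + s] are squares of commuting self-adjoint elements with sum
    [t + 2 s], which bounds [cnorm (a + s)]. With [s = e / 3], two thirds of [e] enter there and the
    last one when [s] is removed. *)
Lemma cnorm_le_of_npos_sub_scalar a t : 0 <= t -> npos a ->
  npos (t%:C%:A - a) -> cnorm a <= t.
Proof.
move=> t_ge0 a_pos ta_pos; apply/ler_addgt0Pr => e e_gt0.
have s_gt0 : 0 < e / 3 by lra.
have [d [d_sa dd d_comm]] := npos_sqrt a_pos s_gt0.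
have [f [f_sa ff f_comm]] := npos_sqrt ta_pos s_gt0.
have fa : f * a = a * f.
  by apply/esym/f_comm; rewrite mulrBl mulrBr mulr_algl mulr_algr.
have fd : f * d = d * f by exact: d_comm.
have : cnorm (d * d) <= t + e / 3 + e / 3.
  apply: (cnorm_sqr_le_of_sum_sqr _ d_sa f_sa); rewrite ?fd //; first lra.
  by rewrite dd ff addrC addrACA subrK !realZDl addrA.
have := cnorm_le_dist a (d * d); rewrite dd opprD addNKr cnormN.
by have := @cnorm_scalar_le R A (e / 3); rewrite gtr0_norm //; lra.
Qed.

(** As [b] lies below the scalar [cnorm b], so does [a], and the scalar case applies. *)
Lemma cnorm_le_of_npos_sub a b : npos a -> npos (b - a) -> cnorm a <= cnorm b.
Proof.
move=> a_pos ba_pos.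
have b_sa : star b = b by rewrite -(subrK a b) starD ba_pos.1 a_pos.1.
apply: cnorm_le_of_npos_sub_scalar (cnorm_ge0 _) a_pos _.
rewrite -(subrKA b); apply: nposD => //; rewrite addrC.
by apply: npos_near_scalar; rewrite ?starN ?b_sa ?cnormN.
Qed.

Lemma npos_inverse a s : npos a -> 0 < s ->
  exists y, mul_inverse (a + s%:C%:A) y /\ s * cnorm y <= 1.
Proof.
move=> [a_sa [t ta]] s_gt0.
have t_ge0 : 0 <= t := le_trans (cnorm_ge0 _) ta.
have ts_gt0 : 0 < t + s by lra.
have ts_neq0 := lt0r_neq0 ts_gt0.
pose x := (t + s)^-1%:C *: (t%:C%:A - a).
have x_le : (t + s) * cnorm x <= t.
  by rewrite cnormZr gtr0_norm ?invr_gt0 // mulrA divff // mul1r.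
have x_lt1 : cnorm x < 1.
  rewrite -(ltr_pM2l ts_gt0); lra.
have [y [[xy yx] y_le]] := neumann x_lt1.
have aE : a + s%:C%:A = (t + s)%:C *: (1 - x).
  by rewrite scalerBr realZK // opprB addrCA realZDl addrAC subrr add0r.
exists ((t + s)^-1%:C *: y); split; first split.
- by rewrite aE -scalerAl -scalerAr realZK // xy.
- by rewrite aE -scalerAl -scalerAr realZA yx mulVf // scale1r.
rewrite cnormZr gtr0_norm ?invr_gt0 // mulrCA mulrC ler_pdivrMr //.
have : cnorm y * ((t + s) * cnorm x) <= cnorm y * t by rewrite ler_wpM2l ?cnorm_ge0.
have : (t + s) * (cnorm y * (1 - cnorm x)) <= (t + s) * 1 by rewrite ler_pM2l.
lra.
Qed.

(** Invertible elements of the cone are interior. With [c + r = d * d], inverse [w] of [c + r], and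
    [f * f = 1 - 2 r w] commuting with [d], the square of [d * f] is [c + r - 2 r = c - r]. *)
Lemma npos_sub_scalar c y : npos c -> mul_inverse c y ->
  exists r, 0 < r /\ npos (c - r%:C%:A).
Proof.
move=> c_pos [cy yc].
have M_ge0 := cnorm_ge0 y.
(* Chosen so that [r * cnorm y <= 1 / 4]; then [cnorm z <= 4 / 3] and [2 r * cnorm w <= 2 / 3 < 1],
   as the square root [f] demands. *)
pose r := (4 * (cnorm y + 1))^-1.
have r_gt0 : 0 < r by rewrite invr_gt0; lra.
have rM : r * cnorm y <= 4^-1.
  by rewrite mulrC ler_pdivrMr; lra.
pose x := - (r%:C *: y).
have x_le : cnorm x <= 4^-1 by rewrite cnormN cnormZr gtr0_norm.
have x_lt1 : cnorm x < 1 by lra.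
have [z [[xz zx] z_le]] := neumann x_lt1.
have cE : c + r%:C%:A = c * (1 - x).
  by rewrite mulrBr mulr1 mulrN opprK -scalerAr cy.
pose w := z * y.
have cw : (c + r%:C%:A) * w = 1.
  by rewrite cE /w mulrA -[c * _ * z]mulrA xz mulr1.
have wc : w * (c + r%:C%:A) = 1.
  by rewrite cE /w mulrA -[z * y * c]mulrA yc mulr1.
have [d [d_sa dd _]] := npos_sqrt c_pos r_gt0.
have dw : d * w = w * d.
  by apply: (@mul_inverse_comm (d * d)); [rewrite dd; split | rewrite mulrA].
have dwd : d * w * d = 1 by rewrite dw -mulrA dd.
have w_sa : star w = w.
  apply: (@mul_inverse_star (d * d)); first by rewrite dd; split.
  by rewrite starM d_sa.
have z_le2 : cnorm z <= 4 / 3.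
  have : cnorm z * cnorm x <= cnorm z * 4^-1 by rewrite ler_wpM2l ?cnorm_ge0.
  lra.
have w_lt1 : cnorm ((r + r)%:C *: w) < 1.
  rewrite cnormZr gtr0_norm; last lra.
  have : r * cnorm w <= r * (cnorm z * cnorm y) by rewrite ler_pM2l ?cnormM_le.
  have : cnorm z * (r * cnorm y) <= 4 / 3 * 4^-1.
    by rewrite ler_pM ?cnorm_ge0 // mulr_ge0 ?(ltW r_gt0).
  lra.
have [|f [f_sa ff f_comm]] := sqrt_one_sub w_lt1; first by rewrite starZr w_sa.
have df : d * f = f * d by apply: f_comm; rewrite -scalerAl -scalerAr dw.
exists r; split=> //.
have -> : c - r%:C%:A = (d * f) * (d * f).
  rewrite {2}df mulrA -[d * f * f]mulrA ff mulrBr mulr1 mulrBl dd.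
  by rewrite -scalerAr -scalerAl dwd realZDl opprD addrA addrK.
by apply: npos_sqr; rewrite starM d_sa f_sa df.
Qed.

(** The infimum of the shifts [s >= 0] that bring [a] into the cone is attained by closedness; were
    it positive, invertibility there would permit a smaller shift. *)
Lemma npos_of_invertible a : star a = a ->
  (forall s, 0 < s -> exists y, mul_inverse (a + s%:C%:A) y) -> npos a.
Proof.
move=> a_sa a_inv.
pose E := [set s : R | 0 <= s /\ npos (a + s%:C%:A)]%classic.
have E_lb : has_lbound E by exists 0 => s [].
have E_inf : has_inf E.
  split=> //; exists (cnorm a); split; first exact: cnorm_ge0.
  exact: npos_near_scalar.
have infE_ge0 : 0 <= inf E by apply: lb_le_inf => [|s []] //; exact: E_inf.1.
have infE_pos : npos (a + (inf E)%:C%:A).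
  apply: npos_approx => e e_gt0; have [s [_ s_pos] s_lt] := inf_adherent e_gt0 E_inf.
  rewrite -addrA -realZDl -[inf E + e](subrKC s) realZDl addrA.
  by apply: nposD => //; apply: npos_scalar; lra.
move: infE_ge0; rewrite le_eqVlt => /predU1P[infE0|infE_gt0].
  by move: infE_pos; rewrite -infE0 scale0r addr0.
have [y y_inv] := a_inv _ infE_gt0.
have [r [r_gt0 r_pos]] := npos_sub_scalar infE_pos y_inv.
(* Truncated at 0 because [r] may exceed [inf E] while members of [E] are nonnegative. *)
pose s := Num.max 0 (inf E - r).
have /(ge_inf E_lb) : E s.
  split; first by rewrite le_max lexx.
  have -> : s = inf E - r + (s - (inf E - r)) by ring.
  rewrite realZDl realZBl !addrA; apply: nposD => //; apply: npos_scalar.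
  by rewrite subr_ge0 le_max lexx orbT.
by rewrite le_max !leNgt infE_gt0 ltrBlDr ltrDl r_gt0.
Qed.

(** In [R[i]], [0 <= z] forces [z] to be real, so the converse must exclude from the spectrum both
    negative reals and all non-real numbers. *)
Lemma positiveP a : positive a <-> npos a.
Proof.
split=> [[a_sa a_spec]|a_pos].
  apply: npos_of_invertible => // s s_gt0; apply: contrapT => no_inv.
  have : 0 <= (- s)%:C :> R[i].
    apply: a_spec => -[y [yl yr]]; apply: no_inv; exists y.
    by rewrite rmorphN scaleNr opprK in yl yr.
  by rewrite lecE /= eqxx /= oppr_ge0 leNgt s_gt0.
split=> [|z]; first exact: a_pos.1.
rewrite {1}(complexE z); set p := complex.Re z; set q := complex.Im z.
move=> z_spec; rewrite lecE /= -/p -/q.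
have [q0|q_neq0] /= := eqVneq q 0.
  rewrite leNgt; apply/negP => p_lt0; apply: z_spec.
  have [|y [[yl yr] _]] := npos_inverse a_pos (s := - p); first by rewrite oppr_gt0.
  by exists y; rewrite q0 mulr0 addr0 -scaleNr -rmorphN.
exfalso; apply: z_spec.
(* With [w = i q], the product [(b - w) * (b + w) = b * b + q ^+ 2] is a square plus a positive
   scalar, hence invertible, and so is the factor [b - w = a - z]. *)
pose b := a - p%:C%:A; pose w : A := ('i * q%:C)%:A.
have b_sa : star b = b by rewrite starB a_pos.1 star_scalar.
have bw : b * w = w * b by rewrite mulr_algl mulr_algr.
have ww : w * w = - (q ^+ 2)%:C%:A.
  rewrite mulr_algl scalerA -scaleNr; congr (_ *: _).
  by rewrite mulrACA -!expr2 sqr_i mulN1r -rmorphXn.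
have abw : a - (p%:C + 'i * q%:C)%:A = b - w by rewrite scalerDl opprD addrA.
clearbody b w.
have q2_gt0 : 0 < q ^+ 2 by rewrite exprn_even_gt0.
have [y [y_inv _]] := npos_inverse (npos_sqr b_sa) q2_gt0.
have lr : (b - w) * (b + w) = b * b + (q ^+ 2)%:C%:A.
  by rewrite mulrDr !mulrBl bw ww opprK addrA subrK.
have rl : (b + w) * (b - w) = b * b + (q ^+ 2)%:C%:A.
  by rewrite mulrBr !mulrDl bw ww opprD opprK addrA addrK.
have yb : (b - w) * y = y * (b - w).
  by apply: mul_inverse_comm y_inv _; rewrite -{1}rl -lr mulrA.
exists ((b + w) * y); rewrite abw.
split; first by rewrite -mulrA -yb mulrA rl y_inv.1.
by rewrite mulrA lr y_inv.1.
Qed.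

End PositiveElements.

(** * Inner products, and the passage from norm to order inequalities *)

Section HilbertModules.
Context {R : realType} {A : cstarAlgType R} {H : hilbertModType A}.
Implicit Types (h : A) (x y : H) (J : set nat).

Lemma innerDr x y z : inner x (y + z) = inner x y + inner x z :> A.
Proof. by rewrite inner_star innerDl starD -!inner_star. Qed.

Lemma innerZZ h x y : inner (h *: x) (h *: y) = h * inner x y * star h.
Proof. by rewrite innerZl inner_star innerZl starM -inner_star mulrA. Qed.

Lemma innerNl x y : inner (- x) y = - inner x y :> A.
Proof. by rewrite -scaleN1r innerZl mulN1r. Qed.

Lemma innerNr x y : inner x (- y) = - inner x y :> A.
Proof. by rewrite inner_star innerNl starN -inner_star. Qed.

Lemma inner_injl x y : (forall z, inner x z = inner y z) -> x = y.
Proof.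
move=> xy; apply/eqP; rewrite -subr_eq0; apply/eqP/inner_eq0.
by rewrite innerDl innerNl xy subrr.
Qed.

(** Linearity is not a field of [adjointable]; it follows from the existence of an adjoint. Stating
    it for a pair of maps serves both an operator and its adjoint. *)
Lemma adjoint_pair_scale (f g : H -> H) :
  (forall x y, inner (f x) y = inner x (g y)) -> forall h x, f (h *: x) = h *: f x.
Proof.
by move=> fg h x; apply: inner_injl => z; rewrite fg !innerZl fg.
Qed.

Lemma aopZ (T : adjointable H) h x : T (h *: x) = h *: T x.
Proof. exact: adjoint_pair_scale (@adjP _ _ _ T) h x. Qed.

Lemma adjZ (T : adjointable H) h x : adj T (h *: x) = h *: adj T x.
Proof.
apply: (@adjoint_pair_scale _ T) => y z.
by rewrite inner_star -adjP -inner_star.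
Qed.

Lemma npos_inner x : npos (inner x x).
Proof. exact/positiveP/inner_ge0. Qed.

Lemma inner_scalarZ (z : R[i]) x : inner (z%:A *: x) (z%:A *: x) =
  (ComplexField.Normc.normc z ^+ 2)%:C *: inner x x.
Proof.
rewrite innerZZ starZ star1 mulr_algl -scalerAl mulr_algr scalerA.
by rewrite -normCK rmorphXn.
Qed.

Lemma inner_parallelogram x y : inner (x - y) (x - y) =
  2%:C *: inner x x + 2%:C *: inner y y - inner (x + y) (x + y) :> A.
Proof.
have double a : 2%:C *: a = a + a :> A by rewrite -[2]/(1 + 1) realZDl scale1r.
apply/eqP; rewrite eq_sym subr_eq eq_sym addrC; apply/eqP.
rewrite !innerDl !innerDr !innerNl !innerNr opprK !double.
by rewrite addrACA [X in X + _]addrACA [X in _ + X]addrACA !subrr addr0 add0r.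
Qed.

Lemma inner_sum_le (I : Type) (s : seq I) (F : I -> H) :
  npos ((2 ^+ size s)%:C *: (\sum_(i <- s) inner (F i) (F i))
        - inner (\sum_(i <- s) F i) (\sum_(i <- s) F i)).
Proof.
elim: s => [|i s IHs] /=.
  rewrite !big_nil scaler0 -(scale0r (0 : H)) innerZl mul0r subrr.
  exact: npos0.
rewrite !big_cons; move: (F i) (\sum_(j <- s) F j) IHs => y z.
move: (\sum_(j <- s) _) => Q; have : 1 <= 2 ^+ size s :> R.
  by rewrite exprn_ege1 // ler1n.
rewrite exprS; move: (2 ^+ size s) => N N_ge1 IHs.
(* The target becomes [(2 N - 2) <y, y>], plus twice the induction hypothesis, plus
   [<y - z, y - z>]. *)
have regroup (a b c d e : A) : a + c - e = a - b + (c - d + (b + d - e)).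
  by rewrite [b + d]addrC -(addrA d) subrKA [c + _]addrCA subrKA addrA.
rewrite scalerDr (regroup _ (2%:C *: inner y y) _ (2%:C *: inner z z)).
rewrite -inner_parallelogram -realZBl -(realZA 2 N) -scalerBr.
apply: nposD; first by apply: nposZ (npos_inner _); lra.
by apply: nposD (npos_inner _); apply: nposZ.
Qed.

(** The quadratic scaling laws allow testing the norm bound at [h *: x] and carrying the outcome
    back to [x]; [q < 1] leaves room for the Neumann series. *)
Lemma npos_sub_of_cnorm_le (Phi Psi : H -> A) (q : R) : 0 <= q -> q < 1 ->
  (forall x, npos (Phi x)) -> (forall x, npos (Psi x)) ->
  (forall h x, Phi (h *: x) = h * Phi x * star h) ->
  (forall h x, Psi (h *: x) = h * Psi x * star h) ->
  (forall x, cnorm (Psi x) <= q * cnorm (Phi x)) ->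
  forall x, npos (Phi x - Psi x).
Proof.
move=> q_ge0 q_lt1 Phi_pos Psi_pos PhiZ PsiZ Psi_le x.
apply: npos_of_invertible => [|s s_gt0].
  by rewrite starB (Phi_pos x).1 (Psi_pos x).1.
have [g [g_sa gg _]] := npos_sqrt (Phi_pos x) s_gt0.
have [y [y_inv y_le]] := npos_inverse (Phi_pos x) s_gt0.
rewrite -gg in y_inv.
have gg_sa : star (g * g) = g * g by rewrite starM g_sa.
have y_sa := mul_inverse_star y_inv gg_sa.
have gy : g * y = y * g by apply: mul_inverse_comm y_inv _; rewrite mulrA.
case: y_inv => ggy ygg.
(* Since [y] inverts [g * g] and commutes with [g], this is the two-sided inverse of [g]. *)
pose h := y * g.
have h_sa : star h = h by rewrite starM g_sa y_sa gy.
have hg : h * g = 1 by rewrite -mulrA.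
have gh : g * h = 1 by rewrite /h -gy mulrA.
have hh : h * h = y by rewrite {1}/h -mulrA gh mulr1.
clearbody h.
have PhiE : Phi x = g * g - s%:C%:A by rewrite gg addrK.
have Phi_hx : Phi (h *: x) = 1%:C%:A - ((Num.sqrt s)%:C *: h) * ((Num.sqrt s)%:C *: h).
  rewrite PhiZ h_sa PhiE mulrBr mulrBl mulr_algr [h * (g * g)]mulrA hg mul1r gh.
  by rewrite -!scalerAl -!scalerAr realZA -(expr2 (Num.sqrt s)) sqr_sqrtr ?(ltW s_gt0) // scale1r.
(* Here [s * cnorm (h * h) = s * cnorm y <= 1], so subtracting the square [s * h * h] from 1 keeps
   the norm at most 1. *)
have Phi_le : cnorm (Phi (h *: x)) <= 1.
  rewrite Phi_hx; apply: cnorm_scalar_sub_sqr_le; first by rewrite starZr h_sa.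
  rewrite cnormZr exprMn ger0_norm ?sqrtr_ge0 // sqr_sqrtr ?(ltW s_gt0) //.
  by rewrite -cnorm_sqr // hh.
have Psi_lt1 : cnorm (Psi (h *: x)) < 1.
  apply: le_lt_trans (Psi_le _) _; apply: le_lt_trans q_lt1.
  by rewrite ler_piMr.
have [z [[z_r z_l] _]] := neumann Psi_lt1.
have -> : Phi x - Psi x + s%:C%:A = g * (1 - Psi (h *: x)) * g.
  rewrite PsiZ h_sa mulrBr mulr1 mulrBl !mulrA gh mul1r -!mulrA hg mulr1 gg.
  by rewrite addrAC.
exists (h * z * h); split.
  by rewrite -!mulrA [g * (h * _)]mulrA gh mul1r [(1 - _) * (z * h)]mulrA z_r mul1r.
by rewrite -!mulrA [h * (g * _)]mulrA hg mul1r [z * (_ * g)]mulrA z_l mul1r.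
Qed.

End HilbertModules.

(** * Comparison of series in the cone *)

Section DominatedSeries.
Context {R : realType} {A : cstarAlgType R} {H : hilbertModType A}.
Implicit Types (J : set nat) (x : nat -> H) (f g : nat -> A).

(** Blocks of [f] lie below blocks of [g] in order, hence in norm, so the partial sums are Cauchy;
    [L - s] is a limit of elements of the cone. *)
Lemma dominated_series J f g (L : A) :
  (forall i, npos (f i)) -> (forall i, npos (g i - f i)) ->
  cvg_in_norm cnorm (fun m => \sum_(0 <= i < m | i \in J) g i) L ->
  exists s, cvg_in_norm cnorm (fun m => \sum_(0 <= i < m | i \in J) f i) s /\
    npos (L - s).
Proof.
move=> f_pos gf_pos gL.
pose F m := \sum_(0 <= i < m | i \in J) f i.
pose G m := \sum_(0 <= i < m | i \in J) g i.
have FG m n : (m <= n)%N -> cnorm (F n - F m) <= cnorm (G n - G m).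
  move=> mn; have tail e : \sum_(0 <= i < n | i \in J) e i -
      \sum_(0 <= i < m | i \in J) e i = \sum_(m <= i < n | i \in J) e i :> A.
    by rewrite -(addKr (\sum_(0 <= i < m | i \in J) e i)
      (\sum_(m <= i < n | _) _)) addrC; congr (_ + _); exact: big_cat_nat.
  rewrite /F /G !tail.
  by apply: cnorm_le_of_npos_sub; [|rewrite -sumrB]; exact: npos_sum.
have [s Fs] : exists s, cvg_in_norm cnorm F s.
  apply: cnorm_complete => e e_gt0; have e2 : 0 < e / 2 by lra.
  have [N hN] := (cvg_in_normP _ _).1 gL _ e2; exists N => m n Nm Nn.
  have G_lt : cnorm (G m - G n) < e.
    have := cnorm_dist L (G m) (G n); have := hN m Nm; have := hN n Nn.
    by rewrite -/(G m) -/(G n) (cnormBC L); lra.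
  apply: le_lt_trans G_lt; case/orP: (leq_total m n) => mn; last exact: FG.
  by rewrite cnormBC (cnormBC (G m)); exact: FG.
exists s; split=> //; apply: (@npos_lim _ _ (fun m => G m - F m)).
  by move=> m; rewrite -sumrB; exact: npos_sum.
apply: cvg_in_normD gL _; have := cvg_in_normZ (-1) Fs.
by rewrite scaleN1r; apply: cvg_in_norm_ext => n; rewrite scaleN1r.
Qed.

Lemma l2_sum_cvg J x : in_l2 J x ->
  cvg_in_norm cnorm (l2_partial_sums J x) (l2_sum J x).
Proof. exact: xgetPex. Qed.

Lemma l2_sumE J x s : cvg_in_norm cnorm (l2_partial_sums J x) s -> l2_sum J x = s.
Proof.
by move=> xs; apply: cvg_in_norm_unique (xs); apply: l2_sum_cvg; exists s.
Qed.

Lemma l2_sum_npos J x : in_l2 J x -> npos (l2_sum J x).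
Proof.
move=> /l2_sum_cvg; apply: npos_lim => m.
by apply: npos_sum => i; exact: npos_inner.
Qed.

(** The quadratic scaling law demanded by [npos_sub_of_cnorm_le]. *)
Lemma l2_sumZ J x (h : A) : in_l2 J x ->
  l2_sum J (fun i => h *: x i) = h * l2_sum J x * star h.
Proof.
move=> /l2_sum_cvg/(cvg_in_normMlr h (star h)) hx; apply: l2_sumE.
apply: cvg_in_norm_ext hx => m; rewrite /l2_partial_sums mulr_sumr mulr_suml.
by apply: eq_bigr => i _; rewrite innerZZ.
Qed.

Lemma l2_dominated (I : finType) J (c : I -> R) (y : I -> nat -> H) x :
  (forall j, in_l2 J (y j)) ->
  (forall i, npos (\sum_j (c j)%:C *: inner (y j i) (y j i) - inner (x i) (x i))) ->
  in_l2 J x /\ npos (\sum_j (c j)%:C *: l2_sum J (y j) - l2_sum J x).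
Proof.
move=> y_l2 xy_pos.
have y_cvg : cvg_in_norm cnorm
    (fun m => \sum_(0 <= i < m | i \in J) \sum_j (c j)%:C *: inner (y j i) (y j i))
    (\sum_j (c j)%:C *: l2_sum J (y j)).
  apply: cvg_in_norm_ext (cvg_in_norm_sum
    (fun j => cvg_in_normZ (c j)%:C (l2_sum_cvg (y_l2 j)))) => m.
  by rewrite exchange_big; apply: eq_bigr => j _; rewrite scaler_sumr.
have [s [xs s_pos]] := dominated_series (fun i => npos_inner (x i)) xy_pos y_cvg.
by split; [exists s | rewrite (l2_sumE xs)].
Qed.

End DominatedSeries.

(** * Linear combinations of K-operator frames *)

Unset Implicit Arguments.

Theorem theorem5p8 (R : realType) (A : cstarAlgType R) (H : hilbertModType A)
    (K : adjointable H) (J : set nat) (k : nat) (k_gt0 : (0 < k)%N)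
    (T : 'I_k -> nat -> adjointable H) (a b : 'I_k -> R)
    (T_frame : forall n, K_operator_frame_with_bounds K J (T n) (a n) (b n))
    (alpha : 'I_k -> R[i]) :
  let S := fun i => aop_lincomb alpha (fun n => T n i) in
  let dominates := exists (lambda : R) (p : 'I_k), 0 < lambda /\
    forall x : H,
      lambda * l2_norm J (fun i => T p i x) <= l2_norm J (fun i => S i x) in
  (dominates -> K_operator_frame K J S) /\
  (co_isometry K -> K_operator_frame K J S -> dominates).
Proof.
move=> S dominates.
(* [2 ^+ k] comes from [inner_sum_le] with [k] summands, the squared modulus from pulling out
   [alpha n]. *)
pose c n := 2 ^+ k * ComplexField.Normc.normc (alpha n) ^+ 2.
have c_ge0 n : 0 <= c n by rewrite mulr_ge0 ?sqr_ge0 ?exprn_ge0.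
have T_l2 n x : in_l2 J (fun i => T n i x) by case: (T_frame n) => _ _ /(_ x)[].
have S_dominated x : in_l2 J (fun i => S i x) /\
    npos (\sum_n (c n)%:C *: l2_sum J (fun i => T n i x) - l2_sum J (fun i => S i x)).
  apply: l2_dominated => [n|i]; first exact: T_l2.
  have := inner_sum_le (index_enum 'I_k) (fun n => (alpha n)%:A *: T n i x).
  rewrite [size _](_ : _ = k); last by rewrite -[RHS](card_ord k) cardT enumT.
  congr npos; congr (_ - _); rewrite scaler_sumr; apply: eq_bigr => n _.
  by rewrite inner_scalarZ realZA.
split=> [[lambda [p [lambda_gt0 dom]]]|K_coiso [aS [bS [aS_gt0 bS_gt0 S_frame]]]].
  have [ap_gt0 _ Tp_frame] := T_frame p.
  have cb_ge0 : 0 <= \sum_n c n * b n.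
    by apply: sumr_ge0 => n _; case: (T_frame n) => _ /ltW b_ge0 _; rewrite mulr_ge0.
  (* Halving [lambda ^+ 2 * a p] provides the factor [q = 1 / 2] of the norm comparison; adding 1
     keeps the upper bound positive even if every [alpha n] is zero. *)
  exists (lambda ^+ 2 * a p / 2), (\sum_n c n * b n + 1); split; try lra.
    by rewrite divr_gt0 // mulr_gt0 // exprn_gt0.
  move=> x; split; first exact: (S_dominated x).1.
    apply/positiveP.
    apply: (@npos_sub_of_cnorm_le _ _ _ (fun x => l2_sum J (fun i => S i x))
      (fun x => (lambda ^+ 2 * a p / 2)%:C *: inner (adj K x) (adj K x)) 2^-1).
    - by rewrite invr_ge0.
    - by rewrite invf_lt1 // ltr1n.
    - by move=> y; apply: l2_sum_npos; exact: (S_dominated y).1.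
    - move=> y; apply: nposZ (npos_inner _).
      by rewrite divr_ge0 // mulr_ge0 ?exprn_ge0 // ltW.
    - move=> h y; rewrite -l2_sumZ; last exact: (S_dominated y).1.
      by congr (l2_sum J _); apply: funext => i; exact: aopZ.
    - by move=> h y /=; rewrite adjZ innerZZ scalerAl scalerAr.
    (* The lower frame bound of [T p], taken in norm, is chained with the squared domination
       inequality. *)
    - move=> y; have [_ /positiveP Ky_le _] := Tp_frame y.
      have := cnorm_le_of_npos_sub (nposZ (ltW ap_gt0) (npos_inner _)) Ky_le.
      rewrite !cnormZr !gtr0_norm //; last first.
        by rewrite divr_gt0 // mulr_gt0 // exprn_gt0.
      have : lambda ^+ 2 * cnorm (l2_sum J (fun i => T p i y)) <=
          cnorm (l2_sum J (fun i => S i y)).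
        have := dom y; rewrite /l2_norm -(ler_sqr (x := lambda * _)) ?nnegrE.
        - by rewrite exprMn !sqr_sqrtr ?cnorm_ge0.
        - by rewrite mulr_ge0 ?sqrtr_ge0 ?ltW.
        - exact: sqrtr_ge0.
      set t := cnorm (l2_sum J _) => S_ge T_ge.
      have : lambda ^+ 2 * (a p * cnorm (inner (adj K y) (adj K y))) <= lambda ^+ 2 * t.
        by rewrite ler_pM2l ?exprn_gt0.
      lra.
  apply/positiveP.
  (* Three elements of the cone: the weighted upper frame bounds, the domination of [S], and
     [<x, x>] from the added 1. *)
  have -> : (\sum_n c n * b n + 1)%:C *: inner x x - l2_sum J (fun i => S i x) =
      \sum_n (c n)%:C *: ((b n)%:C *: inner x x - l2_sum J (fun i => T n i x)) +
      (\sum_n (c n)%:C *: l2_sum J (fun i => T n i x) - l2_sum J (fun i => S i x)) +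
      inner x x.
    rewrite realZDl scale1r addrAC; congr (_ + _).
    rewrite addrA -big_split /=; congr (_ - _).
    rewrite rmorph_sum scaler_suml; apply: eq_bigr => n _.
    by rewrite scalerBr subrK realZA.
  apply: nposD (npos_inner _); apply: nposD (S_dominated x).2.
  apply: npos_sum => n; apply: nposZ => //; apply/positiveP.
  by case: (T_frame n) => _ _ /(_ x)[].
have [_ bp_gt0 Tp_frame] := T_frame (Ordinal k_gt0).
(* Any index would serve as [p]. In norm, the [T p] series is at most [b p * cnorm (inner x x)] and,
   [K] being a co-isometry, the [S] series is at least [aS * cnorm (inner x x)]; the quotient of the
   constants is [lambda ^+ 2]. *)
exists (Num.sqrt (aS / b (Ordinal k_gt0))), (Ordinal k_gt0); split.
  by rewrite sqrtr_gt0 divr_gt0.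
move=> x; rewrite /l2_norm -sqrtrM; last by rewrite divr_ge0 // ltW.
apply: ler_wsqrtr.
have [_ /positiveP S_ge _] := S_frame x.
have [Tx_l2 _ /positiveP T_le] := Tp_frame x.
have := cnorm_le_of_npos_sub (nposZ (ltW aS_gt0) (npos_inner _)) S_ge.
have := cnorm_le_of_npos_sub (l2_sum_npos Tx_l2) T_le.
have KxE : cnorm (inner (adj K x) (adj K x)) = cnorm (inner x x).
  have := K_coiso x; rewrite /hnorm => /(congr1 (fun r => r ^+ 2)).
  by rewrite !sqr_sqrtr ?cnorm_ge0.
rewrite !cnormZr !gtr0_norm // KxE => T_norm S_norm.
apply: le_trans S_norm; rewrite -mulrA ler_pM2l // mulrC ler_pdivrMr //.
by rewrite mulrC.
Qed.
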